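(* Let $\pi$ be a special double poset and let $\nu$ be an integer partition. Then the scalar product $\langle\pi,\pi_\nu\rangle$, that is, the number of pictures from $\pi$ to $\pi_\nu$, is equal to each of the following: (i) the number of lattice permutations of weight $\nu$ whose complements fit into $\pi$; (ii) the number of lattice permutations of weight $\nu$ whose mirror images fit into $\tilde\pi$.
   Context: A double poset is a triple $(E,<_1,<_2)$, where $E$ is a finite set and $<_1,<_2$ are two (strict) partial orders on $E$ (first and second order). It is special if $<_2$ is total. For a special double poset $\pi=(E,<_1,<_2)$ with $|E|=n$, its labelling $\omega$ is the unique order isomorphism $(E,<_2)\to\{1,\dots,n\}$. The special double poset $\tilde\pi$ is obtained from $\pi$ by replacing both orders by their opposites. A picture from $E$ to $F$ is a bijection $\phi:E\to F$ such that $e<_1e'$ implies $\phi(e)<_2\phi(e')$ and $f<_1f'$ implies $\phi^{-1}(f)<_2\phi^{-1}(f')$; $\langle E,F\rangle$ is the number of pictures from $E$ to $F$. A $\pi$-partition is a function $x$ from $E$ to a totally ordered set such that (a) $e<_1e'$ implies $x(e)\le x(e')$, and (b) $e<_1e'$ and $e\ge_2e'$ imply $x(e)<x(e')$. A word $a_1\cdots a_n$ of length $n=|E|$ over a totally ordered alphabet fits into $\pi$ if the function $e\mapsto a_{\omega(e)}$ is a $\pi$-partition; words of length different from $|E|$ do not fit into $\pi$. A lattice permutation is a word on the symbols $1,2,3,\dots$ such that, for every $i\ge 1$, in each left factor (prefix) the number of $i$'s is not less than the number of $(i+1)$'s. Its weight is the partition $\nu=(\nu_1\ge\nu_2\ge\cdots)$,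 where $\nu_i$ is the number of $i$'s in the word. The complement of a word with greatest symbol $k$ is obtained by replacing each letter $j$ by $k+1-j$. The mirror image of $a_1\cdots a_n$ is $a_n\cdots a_1$. For a partition $\nu=(\nu_1\ge\nu_2\ge\cdots)$, $\pi_\nu=(E_\nu,<_1,<_2)$ is the special double poset with $E_\nu=\{(x,y):y\ge1,\ 1\le x\le\nu_y\}$ the Ferrers diagram of $\nu$; $<_1$ is the order induced by the natural (componentwise) partial order of $\mathbb N\times\mathbb N$; and $(x,y)<_2(x',y')$ if and only if either $y>y'$, or $y=y'$ and $x<x'$. *)

(* Defs.v *)
From mathcomp Require Import all_boot all_order.

Set Implicit Arguments.
Unset Strict Implicit.
Unset Printing Implicit Defensive.

Import Order.TTheory.

Record doublePoset := DoublePoset {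
  carrier :> finType;
  lt1 : rel carrier;
  lt2 : rel carrier;
  lt1_irr : irreflexive lt1;
  lt1_trans : transitive lt1;
  lt2_irr : irreflexive lt2;
  lt2_trans : transitive lt2
}.

Definition special (P : doublePoset) : Prop :=
  forall e f : P, e != f -> lt2 e f || lt2 f e.

Section Dual.
Variable P : doublePoset.

Lemma dual_irr (T : Type) (r : rel T) :
  irreflexive r -> irreflexive (fun x y => r y x).
Proof. by move=> r_irr x; apply: r_irr. Qed.

Lemma dual_trans (T : Type) (r : rel T) :
  transitive r -> transitive (fun x y => r y x).
Proof. by move=> r_tr y x z ryx rzy; apply: r_tr rzy ryx. Qed.

Definition dual_poset : doublePoset :=
  DoublePoset (dual_irr (@lt1_irr P)) (dual_trans (@lt1_trans P))
              (dual_irr (@lt2_irr P)) (dual_trans (@lt2_trans P)).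

End Dual.

Definition is_picture (E F : doublePoset) (phi : {ffun E -> F}) : bool :=
  [exists psi : {ffun F -> E},
    [&& [forall e, psi (phi e) == e],
        [forall f, phi (psi f) == f],
        [forall e, forall e', lt1 e e' ==> lt2 (phi e) (phi e')] &
        [forall f, forall f', lt1 f f' ==> lt2 (psi f) (psi f')]]].

Definition num_pictures (E F : doublePoset) : nat :=
  #|[set phi : {ffun E -> F} | is_picture phi]|.

Definition is_labelling (P : doublePoset) (om : P -> nat) : Prop :=
  [/\ {mono om : e f / lt2 e f >-> e < f},
      forall e, 1 <= om e <= #|P|
    & forall i, 1 <= i <= #|P| -> exists e, om e = i].

(** The rank for [lt2], counted from 1; [labelling_iso] and [is_labelling_unique]
    show that, when [P] is special, it is the unique order isomorphism from
    [(P, lt2)] to [{1, .., #|P|}]. *)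
Definition labelling (P : doublePoset) (e : P) : nat :=
  #|[set f : P | lt2 f e]|.+1.

Lemma labelling_iso (P : doublePoset) :
  special P -> is_labelling (@labelling P).
Proof.
move=> sP.
have lt_lab (e f : P) : lt2 e f -> labelling e < labelling f.
  move=> lef; rewrite /labelling ltnS; apply: proper_card; apply/properP; split.
    by apply/subsetP => g; rewrite !inE => lge; apply: lt2_trans lge lef.
  by exists e; rewrite inE ?lef // lt2_irr.
have mono : {mono @labelling P : e f / lt2 e f >-> e < f}.
  move=> e f; apply/idP/idP => [lt_ef|]; last exact: lt_lab.
  have nef : e != f by apply/negP => /eqP ef; rewrite ef ltnn in lt_ef.
  case/orP: (sP e f nef) => // /lt_lab lt_fe.
  by have := ltn_trans lt_ef lt_fe; rewrite ltnn.
have bnd (e : P) : 1 <= labelling e <= #|P|.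
  rewrite /labelling /= -cardsT; apply: proper_card; apply/properP.
  by split; [exact: subsetT | exists e; rewrite inE ?lt2_irr].
split=> // i /andP[i_gt0 le_i].
have pf (e : P) : (labelling e).-1 < #|P| by case/andP: (bnd e).
pose g e : 'I_#|P| := Ordinal (pf e).
have g_inj : injective g.
  move=> e f [eq_ef]; apply/eqP; apply: contraT => /sP /orP[] /lt_lab;
    by rewrite /labelling eq_ef ltnn.
have lt_i : i.-1 < #|P| by rewrite prednK.
have [e ei] : exists e, Ordinal lt_i = g e.
  by apply/codomP; apply: inj_card_onto; rewrite ?card_ord.
by exists e; case: ei => ei; rewrite -(prednK i_gt0) ei.
Qed.

Lemma is_labelling_unique (P : doublePoset) (om : P -> nat) :
  is_labelling om -> om =1 @labelling P.
Proof.
case=> mono bnd onto e; rewrite /labelling.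
have uniq_om : uniq [seq om f | f <- enum P].
  apply: (@leq_size_uniq _ (iota 1 #|P|)); first exact: iota_uniq.
    move=> i; rewrite mem_iota add1n ltnS => /onto[f <-].
    by apply: map_f; rewrite mem_enum.
  by rewrite size_map size_iota -cardE.
have om_gt0 : 0 < om e by case/andP: (bnd e).
have uniq_S : uniq [seq om f | f <- enum P & lt2 f e].
  by apply: subseq_uniq uniq_om; apply: map_subseq; apply: filter_subseq.
have perm_S : perm_eq [seq om f | f <- enum P & lt2 f e] (iota 1 (om e).-1).
  apply: uniq_perm; rewrite ?iota_uniq // => i.
  rewrite mem_iota add1n prednK //; apply/mapP/idP => [[f]|/andP[i_gt0 lt_i]].
    by rewrite mem_filter -mono => /andP[lt_fe _] ->; case/andP: (bnd f) => ->.
  have /onto[f fi] : 1 <= i <= #|P|.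
    by rewrite i_gt0; case/andP: (bnd e) => _; apply/leq_trans/ltnW.
  by exists f; rewrite // mem_filter mem_enum -mono fi lt_i.
have := perm_size perm_S; rewrite size_map size_iota => sz.
rewrite -(prednK om_gt0) -sz cardsE cardE; congr _.+1.
by rewrite enumT.
Qed.

Definition is_ppartition (P : doublePoset) d (T : orderType d)
    (x : P -> T) : Prop :=
  (forall e f : P, lt1 e f -> (x e <= x f)%O) /\
  (forall e f : P, lt1 e f -> (e == f) || lt2 f e -> (x e < x f)%O).

(** The letter [a_i] of [w = a_1 .. a_n] is [nth a0 w i.-1]; the default [a0] is
    never used, because labels do not exceed [size w]. *)
Definition fits (P : doublePoset) d (T : orderType d) (w : seq T) : Prop :=
  size w = #|P| /\
  forall a0 : T, is_ppartition (fun e : P => nth a0 w (labelling e).-1).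

Definition is_partition (nu : seq nat) : bool :=
  sorted geq nu && (0 \notin nu).

(** [part nu i] is the part [nu_i], for [i >= 1]; it is [0] beyond the last
    nonzero part. *)
Definition part (nu : seq nat) (i : nat) : nat := nth 0 nu i.-1.

Definition lattice_permutation (w : seq nat) : Prop :=
  (forall j, j \in w -> 1 <= j) /\
  (forall i u, 1 <= i -> prefix u w -> count_mem i.+1 u <= count_mem i u).

Definition has_weight (w nu : seq nat) : Prop :=
  forall i, 1 <= i -> count_mem i w = part nu i.

Definition complement (w : seq nat) : seq nat :=
  [seq (\max_(i <- w) i).+1 - j | j <- w].

Definition cells (nu : seq nat) : seq (nat * nat) :=
  [seq (x, y) | y <- iota 1 (size nu), x <- iota 1 (part nu y)].

Lemma mem_cells (nu : seq nat) (x y : nat) :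
  ((x, y) \in cells nu) = (1 <= y) && (1 <= x <= part nu y).
Proof.
apply/allpairsPdep/idP => [[y' [x' [+ + [-> ->]]]]|/and3P[y_gt0 x_gt0 le_x]].
  by rewrite !mem_iota !add1n !ltnS => /andP[-> _].
exists y, x; rewrite !mem_iota !add1n !ltnS y_gt0 x_gt0 le_x; split=> //=.
rewrite -(prednK y_gt0) ltnNge; apply/negP => le_y.
by move: le_x; rewrite /part nth_default // leqNgt x_gt0.
Qed.

Section Ferrers.
Variable nu : seq nat.

Definition ferrers : finType := seq_sub (cells nu).

Definition ferrers_lt1 (p q : ferrers) : bool :=
  [&& val p != val q, (val p).1 <= (val q).1 & (val p).2 <= (val q).2].

Definition ferrers_lt2 (p q : ferrers) : bool :=
  ((val q).2 < (val p).2) ||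
  ((val p).2 == (val q).2) && ((val p).1 < (val q).1).

Lemma ferrers_lt1_irr : irreflexive ferrers_lt1.
Proof. by move=> p; rewrite /ferrers_lt1 eqxx. Qed.

Lemma ferrers_lt1_trans : transitive ferrers_lt1.
Proof.
move=> q p r; rewrite /ferrers_lt1.
case: (val p) (val q) (val r) => [a b] [c d] [e f] /=.
move=> /and3P[npq ac bd] /and3P[_ ce df].
rewrite (leq_trans ac ce) (leq_trans bd df) !andbT.
apply: contra npq => /eqP[ae bf]; rewrite -{}ae -{}bf in ce df.
by rewrite xpair_eqE !eqn_leq ac bd ce df.
Qed.

Lemma ferrers_lt2_irr : irreflexive ferrers_lt2.
Proof. by move=> p; rewrite /ferrers_lt2 !ltnn andbF. Qed.

Lemma ferrers_lt2_trans : transitive ferrers_lt2.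
Proof.
move=> q p r; rewrite /ferrers_lt2.
case: (val p) (val q) (val r) => [a b] [c d] [e f] /=.
case/orP=> [lt_db|/andP[/eqP-> lt_ac]]; case/orP=> [lt_fd|/andP[/eqP<- lt_ce]].
- by rewrite (ltn_trans lt_fd lt_db).
- by rewrite lt_db.
- by rewrite lt_fd.
- by rewrite eqxx (ltn_trans lt_ac lt_ce) orbT.
Qed.

Definition ferrers_poset : doublePoset :=
  DoublePoset ferrers_lt1_irr ferrers_lt1_trans
              ferrers_lt2_irr ferrers_lt2_trans.

Lemma ferrers_special : special ferrers_poset.
Proof.
move=> p q; rewrite /= /ferrers_lt2 => npq.
have: val p != val q by apply: contra npq => /eqP/val_inj->.
case: (val p) (val q) => [a b] [c d] /=; rewrite xpair_eqE /=.
by case: (ltngtP b d); case: (ltngtP a c).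
Qed.

End Ferrers.

Definition has_card (T : eqType) (Q : T -> Prop) (n : nat) : Prop :=
  exists s : seq T, [/\ uniq s, forall x, x \in s <-> Q x & size s = n].

Lemma has_card_unique (T : eqType) (Q : T -> Prop) (m n : nat) :
  has_card Q m -> has_card Q n -> m = n.
Proof.
case=> s [us sQ <-] [t [ut tQ <-]]; apply/perm_size/uniq_perm => // x.
by apply/idP/idP => [/sQ/tQ|/tQ/sQ].
Qed.

(* Main.v *)
Require Import Defs.
From mathcomp Require Import all_boot all_order.

(** The reading of a picture [phi] from [P] to the Ferrers diagram of [nu] is the
    word of the rows of [phi e], the elements [e] being taken in increasing second
    order.  Each of the two halves of the definition of a picture says something
    about this word.

    The inverse of [phi] increases from [<_1] on the diagram to [<_2] on [P]: the
    cells are visited in an order in which each row fills up from left to right and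
    no cell comes before the one just under it in the previous row.  Thus [phi] is
    a standard tableau, and its reading is a lattice permutation of weight [nu]
    ([picture_weight], [picture_lattice]).  The tableau is recovered from the word,
    because the column of [phi e] counts the occurrences of the letter of [e] up to
    and including [e] ([picture_col]); hence the reading is injective
    ([reading_inj]).

    The map [phi] increases from [<_1] on [P] to [<_2] on the diagram.  Since the
    cells of a row are visited from left to right, the columns can be forgotten:
    [e <_1 f] must force the row of [f] to be smaller than that of [e], or equal to
    it with [e <_2 f].  This is the condition [descending] on the letters of the
    word ([picture_descending]).  Conversely, a descending lattice permutation of
    weight [nu] is the reading of the picture that places [e] in the row given by
    its letter and the column given by the number of occurrences so far
    ([picture_ofP]).  This counts the descending lattice permutations
    ([card_words]).

    Both fitting conditions are the condition [descending] in disguise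
    ([fits_complement], [fits_mirror]): complementing reverses the order of the
    letters, while taking the mirror image and reversing [<_2] cancel out as far as
    positions are concerned, and reversing [<_1] does the rest. *)

Set Implicit Arguments.
Unset Strict Implicit.
Unset Printing Implicit Defensive.

Import Order.TTheory.

(** * Words as functions on a special double poset *)

(** Positions in words are counted from 0, labels from 1. *)
Definition rank (P : doublePoset) (e : P) : nat := (labelling e).-1.

Definition letter (P : doublePoset) (w : seq nat) (e : P) : nat :=
  nth 0 w (rank e).

Definition ranked (P : doublePoset) : seq P :=
  sort (relpre (@rank P) leq) (enum P).

(** For [g] the letters of a word read in increasing second order, this is the
    number of occurrences of [i] in the prefix of length [m]. *)
Definition occ (P : doublePoset) (g : P -> nat) (i m : nat) : nat :=
  #|[set e | (rank e < m) && (g e == i)]|.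

(** The conclusion is the second order of the Ferrers diagram, read on the rows
    alone: within a row, the order of the columns is replaced by [lt2] on [P]. *)
Definition descending (P : doublePoset) (g : P -> nat) : Prop :=
  forall e f, lt1 e f -> (g f < g e) || (g e == g f) && lt2 e f.

Section Reading.
Variables (P : doublePoset) (P_special : special P).

Lemma lt2_rank (e f : P) : lt2 e f = (rank e < rank f).
Proof. by have [mono _ _] := labelling_iso P_special; rewrite -mono. Qed.

Lemma rank_inj : injective (@rank P).
Proof.
move=> e f eq_ef; apply/eqP; apply: contraT => /P_special.
by rewrite !lt2_rank eq_ef ltnn.
Qed.

Lemma rank_lt (e : P) : rank e < #|P|.
Proof. by have [_ bnd _] := labelling_iso P_special; case/andP: (bnd e). Qed.

(** Both sides are increasing lists of [#|P|] distinct numbers below [#|P|]. *)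
Lemma map_rank_ranked : map (@rank P) (ranked P) = iota 0 #|P|.
Proof.
apply: (sorted_eq leq_trans anti_leq).
- by rewrite sorted_map; apply: sort_sorted => e f; apply: leq_total.
- exact: iota_sorted.
have uniq_r : uniq (map (@rank P) (ranked P)).
  by rewrite map_inj_uniq ?sort_uniq ?enum_uniq //; apply: rank_inj.
have sub : {subset map (@rank P) (ranked P) <= iota 0 #|P|}.
  by move=> _ /mapP[e _ ->]; rewrite mem_iota rank_lt.
have [] := uniq_min_size uniq_r sub.
  by rewrite size_iota size_map size_sort -cardE.
by move=> _ eq_r; apply: uniq_perm; rewrite ?iota_uniq.
Qed.

Lemma mem_ranked (e : P) : e \in ranked P.
Proof. by rewrite mem_sort mem_enum. Qed.

Lemma size_ranked : size (ranked P) = #|P|.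
Proof. by rewrite size_sort -cardE. Qed.

Lemma index_ranked (e : P) : index e (ranked P) = rank e.
Proof.
rewrite -(index_map rank_inj) map_rank_ranked.
rewrite -{1}[rank e](@nth_iota 0 0 #|P|) ?rank_lt //.
by rewrite index_uniq ?iota_uniq ?size_iota ?rank_lt.
Qed.

Lemma letter_map (g : P -> nat) : letter (map g (ranked P)) =1 g.
Proof.
move=> e; rewrite /letter (nth_map e) ?size_ranked ?rank_lt //.
by rewrite -index_ranked nth_index ?mem_ranked.
Qed.

Lemma map_letter (w : seq nat) :
  size w = #|P| -> map (@letter P w) (ranked P) = w.
Proof.
move=> sw; rewrite (map_comp (nth 0 w)) map_rank_ranked -sw.
exact: mkseq_nth.
Qed.

(** Since [ranked P] lists the elements by rank, its prefix of length [m] consists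
    of the elements of rank less than [m]. *)
Lemma count_take_map (g : P -> nat) (i m : nat) :
  count_mem i (take m (map g (ranked P))) = occ g i m.
Proof.
rewrite -map_take count_map -size_filter /occ cardE.
apply/perm_size/uniq_perm; rewrite ?enum_uniq //.
  by rewrite filter_uniq // take_uniq // sort_uniq enum_uniq.
move=> e; rewrite mem_filter mem_enum in_set in_take ?mem_ranked //.
by rewrite index_ranked andbC.
Qed.

Lemma count_map_ranked (g : P -> nat) (i : nat) :
  count_mem i (map g (ranked P)) = occ g i #|P|.
Proof. by rewrite -count_take_map take_oversize // size_map size_ranked. Qed.

Lemma occ_mono (g : P -> nat) (i m m' : nat) :
  m <= m' -> occ g i m <= occ g i m'.
Proof.
move=> le_m; apply/subset_leq_card/subsetP => e; rewrite !inE.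
by case/andP=> lt_m ->; rewrite (leq_trans lt_m).
Qed.

(** The element [e] itself is one more occurrence of its letter. *)
Lemma occ_rank (g : P -> nat) (e : P) (m : nat) :
  m <= rank e -> occ g (g e) m < occ g (g e) (rank e).+1.
Proof.
move=> le_m; apply/proper_card/properP; split.
  apply/subsetP => f; rewrite !inE => /andP[lt_m ->].
  by rewrite ltnS ltnW // (leq_trans lt_m).
by exists e; rewrite !inE ?ltnSn ?eqxx // ltnNge le_m.
Qed.


(** * The two fitting conditions *)

(** As the second order is total, the strictness condition of [P]-partitions can be
    read contrapositively: equality of the values is allowed only if [lt2 e f].  The
    auxiliary [x] allows for functions that are only pointwise equal to [y]. *)
Lemma ppartitionE d (T : orderType d) (x y : P -> T) : x =1 y ->
  is_ppartition x <->
  forall e f, lt1 e f -> (y e < y f)%O || (y e == y f) && lt2 e f.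
Proof.
move=> eq_xy; split=> [[le_x lt_x] e f ef|asc].
  rewrite -!eq_xy; have nef : e != f.
    by apply: contraTneq ef => ->; rewrite lt1_irr.
  have := le_x e f ef; rewrite le_eqVlt orbC.
  case/orP: (P_special nef) => [->|fe]; first by rewrite andbT.
  by rewrite lt_x ?fe ?orbT.
split=> e f /[dup] ef /asc; rewrite !eq_xy; first by case/orP=> [/ltW|/andP[/eqP->]].
case/orP=> // /andP[_ lt_ef] /orP[/eqP eq_ef|lt_fe].
  by rewrite eq_ef lt2_irr in lt_ef.
by have := lt2_trans lt_ef lt_fe; rewrite lt2_irr.
Qed.

(** The map [j |-> K.+1 - j] is a decreasing injection on the letters, all of which
    are at most [K]. *)
Lemma fits_complement (w : seq nat) :
  fits P (complement w) <-> size w = #|P| /\ descending (@letter P w).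
Proof.
rewrite /fits size_map; set K := \max_(i <- w) i.
have [sw|nsw] := eqVneq (size w) #|P|; last by split=> -[/eqP]; rewrite (negPf nsw).
have letter_le (e : P) : letter w e <= K.
  by apply: leq_bigmax_seq => //; apply: mem_nth; rewrite sw rank_lt.
have nthE a0 (e : P) :
    nth a0 (complement w) (labelling e).-1 = K.+1 - letter w e.
  by rewrite (nth_map 0) // sw; apply: rank_lt.
have descE (e f : P) :
    (K.+1 - letter w e < K.+1 - letter w f)%O
      || (K.+1 - letter w e == K.+1 - letter w f) && lt2 e f
    = (letter w f < letter w e) || (letter w e == letter w f) && lt2 e f.
  by rewrite ltEnat /= ltn_sub2lE ?eqn_sub2lE // leqW.
split=> -[_ H]; split=> //.
  by move/(_ 0)/(ppartitionE (nthE 0)): H => H e f /H; rewrite descE.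
by move=> a0; apply/(ppartitionE (nthE a0)) => e f /H; rewrite descE.
Qed.

(** Besides [e], each element lies either below or above [e]. *)
Lemma rank_dual (e : P) : (rank (e : dual_poset P) + rank e).+1 = #|P|.
Proof.
have eqC : [set f | lt2 e f] = ~: (e |: [set f | lt2 f e]).
  apply/setP => f; rewrite !inE negb_or !lt2_rank -leqNgt ltn_neqAle.
  by rewrite (inj_eq rank_inj) eq_sym.
rewrite -(cardsC (e |: [set f | lt2 f e])) -eqC cardsU1 inE lt2_irr addnC.
by rewrite add1n.
Qed.

End Reading.

(** By [rank_dual] the letter of [rev w] at the position of [e] in the dual is the
    letter of [w] at the position of [e] in [P]; only the exchange of [e] and [f] in
    [lt1 e f] remains. *)
Lemma fits_mirror (P : doublePoset) (w : seq nat) : special P ->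
  fits (dual_poset P) (rev w) <-> size w = #|P| /\ descending (@letter P w).
Proof.
move=> P_special; rewrite /fits size_rev.
have dual_special : special (dual_poset P).
  by move=> e f /P_special; rewrite orbC.
have [sw|nsw] := eqVneq (size w) #|P|; last by split=> -[/eqP]; rewrite (negPf nsw).
have nthE a0 (e : dual_poset P) :
    nth a0 (rev w) (labelling e).-1 = @letter P w e.
  have eq_n := rank_dual P_special e.
  rewrite nth_rev sw; last by rewrite -eq_n ltnS leq_addr.
  rewrite -eq_n subSS addKn; apply: set_nth_default.
  by rewrite sw; apply: rank_lt.
split=> -[_ H]; split=> //.
  move/(_ 0)/(ppartitionE dual_special (nthE 0)): H => H e f /H.
  by rewrite ltEnat eq_sym.
move=> a0; apply/(ppartitionE dual_special (nthE a0)) => e f /H.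
by rewrite ltEnat eq_sym.
Qed.

(** * The Ferrers diagram *)

Section Pictures.
Variables (P : doublePoset) (P_special : special P) (nu : seq nat).
Hypothesis nu_partition : is_partition nu.
Implicit Types (phi : {ffun P -> ferrers_poset nu}) (p q : ferrers_poset nu).

Definition row p : nat := (val (p : ferrers nu)).2.
Definition col p : nat := (val (p : ferrers nu)).1.

Lemma cellP p : (0 < row p) && (0 < col p <= part nu (row p)).
Proof. by rewrite -mem_cells /row /col -surjective_pairing; apply: (valP p). Qed.

Lemma cell_inj p q : row p = row q -> col p = col q -> p = q.
Proof.
rewrite /row /col => eq_row eq_col; apply: (@val_inj _ _ (ferrers nu)).
by apply/eqP; rewrite [val p]surjective_pairing [val q]surjective_pairing
  eq_row eq_col.
Qed.

Lemma cell_exists x y : 0 < y -> 0 < x <= part nu y ->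
  exists p, col p = x /\ row p = y.
Proof.
move=> y_gt0 le_x; have c_xy : (x, y) \in cells nu by rewrite mem_cells y_gt0.
by exists (SeqSub c_xy).
Qed.

Lemma part_mono y : 0 < y -> part nu y.+1 <= part nu y.
Proof.
case/andP: nu_partition => nu_sorted _; case: y => // y _; rewrite /part /=.
have [lt_y|le_y] := ltnP y.+1 (size nu); last by rewrite nth_default.
have geq_trans : transitive geq by move=> b a c /= ba cb; apply: leq_trans cb ba.
have geq_refl : reflexive geq by move=> a; apply: leqnn.
exact: (sorted_leq_nth geq_trans geq_refl 0 nu_sorted y y.+1 (ltnW lt_y) lt_y).
Qed.

(** With [x] the whole length of the row this counts a row, which gives the weight;
    with [x] the column of a cell it expresses this column as a cardinality, which
    a bijection preserves. *)
Lemma card_row_prefix x y : 0 < y -> x <= part nu y ->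
  #|[set p | (row p == y) && (col p <= x)]| = x.
Proof.
move=> y_gt0 le_x; rewrite cardE -(size_map col) -[RHS](size_iota 1).
apply/perm_size/uniq_perm; rewrite ?iota_uniq //.
  rewrite map_inj_in_uniq ?enum_uniq // => p q; rewrite !mem_enum !inE.
  by case/andP=> /eqP rp _ /andP[/eqP rq _]; apply: cell_inj; rewrite rp.
move=> c; rewrite mem_iota add1n ltnS; apply/mapP/andP => [[p]|[c_gt0 le_c]].
  rewrite mem_enum inE => /andP[_ le_p] ->.
  by have /and3P[_ ->] := cellP p.
have [|p [cp rp]] := @cell_exists c y y_gt0; first by rewrite c_gt0 (leq_trans le_c).
by exists p; rewrite ?mem_enum ?inE ?rp ?cp ?eqxx.
Qed.

Lemma lt1_cellE p q :
  lt1 p q = [&& p != q, col p <= col q & row p <= row q].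
Proof. by rewrite /= /ferrers_lt1 (inj_eq (@val_inj _ _ (ferrers nu))). Qed.

Lemma lt2_cellE p q :
  lt2 p q = (row q < row p) || (row p == row q) && (col p < col q).
Proof. by []. Qed.

(** * From pictures to words *)

(** The inverse map is eliminated: its monotonicity becomes a condition on pairs of
    elements of [P]. *)
Lemma pictureP phi :
  reflect ([/\ bijective phi, forall e f, lt1 e f -> lt2 (phi e) (phi f)
            & forall e f, lt1 (phi e) (phi f) -> lt2 e f])
          (is_picture phi).
Proof.
apply: (iffP existsP) => [[psi]|[bij_phi inc dec]].
  case/and4P=> /'forall_eqP phiK /'forall_eqP psiK.
  move=> /'forall_'forall_implyP inc /'forall_'forall_implyP dec.
  split=> [|//|e f /dec]; first by exists psi.
  by rewrite !phiK.
have [psi phiK psiK] := bij_phi; exists (finfun psi); apply/and4P; split.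
- by apply/'forall_eqP => e; rewrite ffunE.
- by apply/'forall_eqP => f; rewrite ffunE.
- by apply/'forall_'forall_implyP.
by apply/'forall_'forall_implyP => p q pq; rewrite !ffunE dec ?psiK.
Qed.

Definition row_of phi (e : P) : nat := row (phi e).

Definition reading phi : seq nat := map (row_of phi) (ranked P).

(** Cells of one row are comparable for [lt1], so the inverse of a picture visits
    them from left to right. *)
Lemma picture_row_mono phi e f : is_picture phi ->
  row_of phi e = row_of phi f -> (col (phi e) <= col (phi f)) = (rank e <= rank f).
Proof.
case/pictureP=> /bij_inj phi_inj _ dec.
wlog suff lt_rank : e f / row_of phi e = row_of phi f ->
    col (phi e) < col (phi f) -> rank e < rank f.
  move=> eq_row; have [lt_c|lt_c|eq_c] := ltngtP (col (phi e)) (col (phi f)).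
  - by rewrite ltnW // lt_rank.
  - by apply/esym/negbTE; rewrite -ltnNge lt_rank.
  - by rewrite (phi_inj _ _ (cell_inj eq_row eq_c)) leqnn.
rewrite /row_of => eq_row lt_c; rewrite -lt2_rank //; apply: dec.
rewrite lt1_cellE eq_row leqnn ltnW // !andbT.
by apply: contraTneq lt_c => ->; rewrite ltnn.
Qed.

(** By [picture_row_mono] the occurrences counted on the right are the preimages of
    the cells of the row that are not to the right of [phi e]. *)
Lemma picture_col phi e : is_picture phi ->
  col (phi e) = occ (row_of phi) (row_of phi e) (rank e).+1.
Proof.
move=> pic; have [bij_phi _ _] := pictureP _ pic.
have /and3P[row_gt0 col_gt0 col_le] := cellP (phi e).
rewrite -{1}(card_row_prefix row_gt0 col_le).
rewrite -(on_card_preimset (onW_bij _ bij_phi)).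
apply: eq_card => f; rewrite !inE ltnS andbC /row_of.
have [eq_row|] := eqVneq (row (phi f)) (row (phi e)); last by rewrite !andbF.
by rewrite !andbT picture_row_mono.
Qed.

Lemma reading_inj phi phi' : is_picture phi -> is_picture phi' ->
  reading phi = reading phi' -> phi = phi'.
Proof.
move=> pic pic' eq_w; have eq_row : row_of phi =1 row_of phi'.
  by move=> e; rewrite -(letter_map P_special) -/(reading _) eq_w letter_map.
apply/ffunP => e; apply: cell_inj; first exact: eq_row.
rewrite !picture_col // eq_row; apply: eq_card => f.
by rewrite !inE eq_row.
Qed.

Lemma picture_weight phi i : is_picture phi -> 0 < i ->
  occ (row_of phi) i #|P| = part nu i.
Proof.
move=> /pictureP[bij_phi _ _] i_gt0.
rewrite -(card_row_prefix i_gt0 (leqnn _)).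
rewrite -(on_card_preimset (onW_bij _ bij_phi)).
apply: eq_card => e; rewrite !inE rank_lt //= /row_of.
have [eq_i|//] := eqVneq (row (phi e)) i.
by rewrite -eq_i; case/and3P: (cellP (phi e)).
Qed.

(** Each cell of row [i.+1] has a neighbour in row [i] and the same column; it is
    smaller for [lt1], hence visited earlier.  This injects the occurrences of
    [i.+1] in a prefix into those of [i]. *)
Lemma picture_lattice phi i m : is_picture phi -> 0 < i ->
  occ (row_of phi) i.+1 m <= occ (row_of phi) i m.
Proof.
case/pictureP=> -[psi phiK psiK] _ dec i_gt0.
have below e : row_of phi e = i.+1 ->
    exists2 f, lt2 f e & row_of phi f = i /\ col (phi f) = col (phi e).
  move=> re; have /and3P[_ c_gt0 c_le] := cellP (phi e).
  rewrite -/(row_of phi e) re in c_le.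
  (* Since [nu] is decreasing, the neighbour is a cell of the diagram. *)
  have [|p [cp rp]] := @cell_exists (col (phi e)) i i_gt0.
    by rewrite c_gt0 (leq_trans c_le (part_mono i_gt0)).
  exists (psi p); last by rewrite /row_of psiK.
  apply: dec; rewrite psiK lt1_cellE cp rp leqnn -/(row_of phi e) re leqnSn !andbT.
  by apply/eqP => eq_p; move: re; rewrite /row_of -eq_p rp => /n_Sn.
pose up e := odflt e [pick f | [&& lt2 f e, row_of phi f == i
                                 & col (phi f) == col (phi e)]].
have upP e : row_of phi e = i.+1 ->
    [/\ lt2 (up e) e, row_of phi (up e) = i & col (phi (up e)) = col (phi e)].
  move=> /below[f fe [rf cf]]; rewrite /up; case: pickP => [g|/(_ f)].
    by case/and3P=> -> /eqP-> /eqP->.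
  by rewrite fe rf cf !eqxx.
rewrite /occ -(card_in_imset (f := up)) => [|e f]; last first.
  rewrite !inE => /andP[_ /eqP re] /andP[_ /eqP rf] eq_up.
  have [_ _ ce] := upP _ re; have [_ _ cf] := upP _ rf.
  apply: (can_inj phiK); apply: cell_inj; first exact: etrans re (esym rf).
  by rewrite -ce -cf eq_up.
apply/subset_leq_card/subsetP => _ /imsetP[e + ->]; rewrite !inE.
case/andP=> lt_m /eqP /upP[lt_e -> _]; rewrite eqxx andbT.
by apply: ltn_trans lt_m; rewrite -lt2_rank.
Qed.

Lemma picture_descending phi : is_picture phi -> descending (row_of phi).
Proof.
move=> pic e f ef; have [_ inc _] := pictureP _ pic.
have := inc _ _ ef; rewrite lt2_cellE /row_of.
case/orP=> [->//|/andP[/eqP eq_row lt_c]]; apply/orP; right.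
rewrite eq_row eqxx lt2_rank //= ltnNge -(picture_row_mono pic) //.
by rewrite -ltnNge.
Qed.

(** * From words to pictures *)

Section PictureOfWord.
Variable g : P -> nat.
Hypothesis g_gt0 : forall e, 0 < g e.
Hypothesis g_lattice : forall i m, 0 < i -> occ g i.+1 m <= occ g i m.
Hypothesis g_weight : forall i, 0 < i -> occ g i #|P| = part nu i.
Hypothesis g_desc : descending g.

Lemma occ_anti i j m : 0 < i -> i <= j -> occ g j m <= occ g i m.
Proof.
move=> i_gt0; elim: j => [|j IHj]; first by rewrite leqn0 => /eqP->.
rewrite leq_eqVlt => /predU1P[->//|]; rewrite ltnS => le_ij.
exact: leq_trans (g_lattice _ (leq_trans i_gt0 le_ij)) (IHj le_ij).
Qed.

Lemma occ_cell e : (occ g (g e) (rank e).+1, g e) \in cells nu.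
Proof.
rewrite mem_cells g_gt0 /= -g_weight // occ_mono ?rank_lt // andbT.
exact: leq_ltn_trans (leq0n _) (occ_rank g (leqnn (rank e))).
Qed.

Definition picture_of : {ffun P -> ferrers_poset nu} :=
  [ffun e => SeqSub (occ_cell e) : ferrers nu].

Lemma row_picture_of e : row (picture_of e) = g e.
Proof. by rewrite ffunE. Qed.

Lemma col_picture_of e : col (picture_of e) = occ g (g e) (rank e).+1.
Proof. by rewrite ffunE. Qed.

Lemma picture_of_inj : injective picture_of.
Proof.
move=> e f eq_p; have eq_row := congr1 row eq_p; have eq_col := congr1 col eq_p.
rewrite !row_picture_of !col_picture_of in eq_row eq_col.
apply: (rank_inj P_special); case: (ltngtP (rank e) (rank f)) => // lt_r.
  by have := occ_rank g lt_r; rewrite -eq_col eq_row ltnn.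
by have := occ_rank g lt_r; rewrite eq_col eq_row ltnn.
Qed.

(** Injectivity suffices in each row separately: by the weight condition the letter
    [y] occurs exactly as often as row [y] has cells. *)
Lemma picture_of_bij : bijective picture_of.
Proof.
apply: inj_card_bij; first exact: picture_of_inj.
rewrite -(card_codom picture_of_inj); apply/subset_leq_card/subsetP => p _.
have /and3P[row_gt0 _ col_le] := cellP p.
have eq_row : picture_of @: [set e | g e == row p] =
    [set q | (row q == row p) && (col q <= part nu (row p))].
  apply/eqP; rewrite eqEcard card_imset; last exact: picture_of_inj.
  rewrite card_row_prefix //; apply/andP; split.
    apply/subsetP => _ /imsetP[e + ->]; rewrite !inE row_picture_of => /eqP eq_e.
    have /and3P[_ _] := cellP (picture_of e).
    by rewrite row_picture_of eq_e eqxx.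
  rewrite -g_weight //.
  by apply/subset_leq_card/subsetP => e; rewrite !inE => /andP[].
have: p \in picture_of @: [set e | g e == row p] by rewrite eq_row inE eqxx.
by case/imsetP=> e _ ->; apply: codom_f.
Qed.

(** That [phi e] below [phi f] for [lt1] forces [lt2 e f] is where the lattice
    property enters.  If [f] came before [e], then up to [f] the letter of [f] would
    have occurred at least [col (phi e)] times; as the letter of [e] is smaller or
    equal, it would have occurred as often, which is impossible before [e]. *)
Lemma picture_ofP : is_picture picture_of.
Proof.
apply/pictureP; split=> [|e f ef|e f]; first exact: picture_of_bij.
  rewrite lt2_cellE !row_picture_of !col_picture_of.
  case/orP: (g_desc ef) => [->//|/andP[/eqP-> lt_ef]].
  by rewrite eqxx orbC occ_rank // -lt2_rank.
rewrite lt1_cellE (inj_eq picture_of_inj) !row_picture_of !col_picture_of.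
case/and3P=> nef le_col le_row; rewrite lt2_rank // ltnNge; apply/negP => le_r.
have lt_r : rank f < rank e.
  by rewrite ltn_neqAle le_r (inj_eq (rank_inj P_special)) eq_sym nef.
have := leq_trans le_col (occ_anti _ (g_gt0 e) le_row).
by rewrite leqNgt occ_rank.
Qed.

End PictureOfWord.

(** * Counting *)

Lemma card_words :
  has_card (fun w => [/\ lattice_permutation w, has_weight w nu
                       & size w = #|P| /\ descending (@letter P w)])
           (num_pictures P (ferrers_poset nu)).
Proof.
exists (map reading (enum [set phi | is_picture phi])); split.
- rewrite map_inj_in_uniq ?enum_uniq // => phi phi'; rewrite !mem_enum !inE.
  exact: reading_inj.
- move=> w; split=> [/mapP[phi]|[[w_gt0 w_latt] w_wt [sw w_desc]]].
    rewrite mem_enum inE => pic ->; split; first split.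
    + by move=> _ /mapP[e _ ->]; case/andP: (cellP (phi e)).
    + move=> i u i_gt0 /prefixP[v eq_u].
      have -> : u = take (size u) (reading phi) by rewrite eq_u take_size_cat.
      by rewrite !count_take_map // picture_lattice.
    + by move=> i i_gt0; rewrite count_map_ranked // picture_weight.
    split; first by rewrite size_map size_ranked.
    by move=> e f; rewrite !letter_map //; apply: picture_descending.
  have eq_w := map_letter P_special sw.
  have l_gt0 (e : P) : 0 < letter w e.
    by apply: w_gt0; apply: mem_nth; rewrite sw rank_lt.
  have l_latt i m : 0 < i -> occ (@letter P w) i.+1 m <= occ (@letter P w) i m.
    by move=> i_gt0; rewrite -!count_take_map // eq_w w_latt // prefix_take.
  have l_wt i : 0 < i -> occ (@letter P w) i #|P| = part nu i.
    by move=> i_gt0; rewrite -count_map_ranked // eq_w w_wt.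
  apply/mapP; exists (picture_of l_gt0 l_wt).
    by rewrite mem_enum inE picture_ofP.
  rewrite -{1}eq_w; apply: eq_map => e.
  by rewrite /row_of row_picture_of.
by rewrite size_map -cardE.
Qed.

End Pictures.

Lemma has_card_ext (T : eqType) (Q Q' : T -> Prop) (n : nat) :
  (forall x, Q x <-> Q' x) -> has_card Q n -> has_card Q' n.
Proof.
move=> eqQ [s [us sQ sz]]; exists s; split=> // x.
by split=> [/sQ/eqQ|/eqQ/sQ].
Qed.

Theorem theorem3p4 (P : doublePoset) (nu : seq nat)
    (P_special : special P) (nu_partition : is_partition nu) :
  has_card (fun w : seq nat =>
      [/\ lattice_permutation w, has_weight w nu & fits P (complement w)])
    (num_pictures P (ferrers_poset nu)) /\
  has_card (fun w : seq nat =>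
      [/\ lattice_permutation w, has_weight w nu & fits (dual_poset P) (rev w)])
    (num_pictures P (ferrers_poset nu)).
Proof.
split; apply: has_card_ext (card_words P_special nu_partition) => w.
  by split=> -[latt wt /(fits_complement P_special) fit]; split.
by split=> -[latt wt /(fits_mirror w P_special) fit]; split.
Qed.
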